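(* Let $n\geq1$, $\varepsilon>0$, and let $\psi:\mathbb{R}\to[0,\infty)$ satisfy $\psi\in C^2(\mathbb{R})$, $\psi(-y)=\psi(y)$, $\psi(0)=0$, $|\psi'(y)|\leq\nu_1$, $\psi(y)\geq\nu_2|y|-\nu_3$ and $\psi''(y)>0$ for all $y\in\mathbb{R}$, with constants $\nu_1,\nu_2>0$, $\nu_3\in\mathbb{R}$ (so $\psi$ is convex and increasing on $[0,\infty)$). Define $$F^*(p):=\sum_{i=1}^n\psi\Big(\sqrt[4]{\varepsilon^2+\sigma_i(p)^2}\Big),\quad p\in\mathbb{R}^{n\times n}.$$ Then $F^*$ is convex and of class $C^2$ on $\mathbb{R}^{n\times n}$.
   Context: For $p\in\mathbb{R}^{n\times n}$, $\sigma_1(p),\dots,\sigma_n(p)$ denote the eigenvalues of the symmetric positive semidefinite matrix $pp^T$ (counted with multiplicity). *)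

(* Defs.v *)
From HB Require Import structures.
From mathcomp Require Import all_boot all_order all_algebra.
From mathcomp Require Import all_classical all_reals all_analysis.
Set Implicit Arguments. Unset Strict Implicit. Unset Printing Implicit Defensive.
Import Order.TTheory GRing.Theory Num.Theory.
Import numFieldNormedType.Exports.
Local Open Scope classical_set_scope.
Local Open Scope ring_scope.

(* The eigenvalues of a square matrix A counted with multiplicity:
   a sequence s of length n with char_poly A = prod_(x <- s) ('X - x).
   (Chosen via classical choice; for symmetric matrices such as p p^T
   it exists, and its order is irrelevant for symmetric sums.) *)
Definition eigenvalues {R : realType} (n : nat) (A : 'M[R]_n) : seq R :=
  xget [::] [set s : seq R | size s = n /\
                 char_poly A = \prod_(x <- s) ('X - x%:P)].

Definition sigmas {R : realType} (n : nat) (p : 'M[R]_n) : seq R :=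
  eigenvalues (p *m p^T).

Definition Fstar {R : realType} (n : nat) (psi : R -> R) (eps : R)
    (p : 'M[R]_n) : R :=
  \sum_(s <- sigmas p) psi (Num.sqrt (Num.sqrt (eps ^+ 2 + s ^+ 2))).

Definition C2_real {R : realType} (f : R -> R) : Prop :=
  (forall x, derivable f x 1) /\
  (forall x, derivable (derive1 f) x 1) /\
  continuous (derive1 (derive1 f)).

Definition C2_on {R : realType} {V : normedModType R} (f : V -> R) : Prop :=
  (forall x, differentiable f x) /\
  (forall v x, differentiable ('D_v f) x) /\
  (forall v w, continuous ('D_w ('D_v f))).

Definition convex_fun {R : realType} {V : lmodType R} (f : V -> R) : Prop :=
  forall (x y : V) (t : R), 0 <= t <= 1 ->
    f (t *: x + (1 - t) *: y) <= t * f x + (1 - t) * f y.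

(* Main.v *)
(** The eigenvalues of the symmetric dilation [D(p) = [[0, p], [p^T, 0]]] are,
    up to sign, the singular values of [p], so that
    [F*(p) = 1/2 sum_k G(nu_k(D(p)))] with [G(t) = psi((eps^2 + t^4)^(1/4))].
    Since [D] is linear, it is enough to study [A |-> tr G(A)] on symmetric
    matrices.

    Convexity: [G] lies above its tangents, so Jensen's inequality gives
    [sum_i G(<A u_i, u_i>) <= tr G(A)] for every orthonormal basis [u], with
    equality for an eigenbasis of [A].

    Regularity: if [u_i, d_i] and [v_j, e_j] are eigenbases and eigenvalues of
    [A] and [A'], and [h^[1]] is the divided difference of [h], then
    [tr (h(A') B) - tr (h(A) B)
       = sum_ij h^[1](d_i, e_j) <u_i, (A' - A) v_j> <v_j, B u_i>].
    When [h] is C^1 the right-hand side depends continuously on the pair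
    [A, A'], although the eigenbases do not: expanding in an eigenbasis [w_k] of
    a fixed [A0] with eigenvalues [a_k], the coefficient [<u_i, w_k>] is small
    unless [d_i] is close to [a_k]. Hence [A |-> tr (h(A) B)] is C^1, and the
    claim follows by using this for [h = G] and then for [h = G']. *)

Require Import Defs.
From HB Require Import structures.
From mathcomp Require Import all_boot all_order all_algebra.
From mathcomp Require Import all_classical all_reals all_analysis.
From mathcomp Require Import complex ring lra.
Set Implicit Arguments. Unset Strict Implicit. Unset Printing Implicit Defensive.
Import Order.TTheory GRing.Theory Num.Theory.
Import numFieldNormedType.Exports.
Local Open Scope classical_set_scope.
Local Open Scope ring_scope.

(** * Spectral decomposition of real symmetric matrices *)

(** The rows of [U] form an orthonormal eigenbasis of [A], since row vectors act from the left. *)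
Definition spectral_dec (R : realType) n (A U : 'M[R]_n) (d : 'rV[R]_n) : Prop :=
  U *m U^T = 1%:M /\ U *m A = diag_mx d *m U.

Section Spectral.
Variable R : realType.

Lemma mulmx_tr_ge0 n (x : 'rV[R]_n) : 0 <= (x *m x^T) 0 0.
Proof. by rewrite mxE sumr_ge0 // => i _; rewrite mxE -expr2 sqr_ge0. Qed.

Lemma mulmx_tr_eq0 n (x : 'rV[R]_n) : (x *m x^T) 0 0 = 0 -> x = 0.
Proof.
rewrite mxE => /eqP; rewrite psumr_eq0; last first.
  by move=> i _; rewrite mxE -expr2 sqr_ge0.
move=> /allP x0; apply/rowP => i; have := x0 i (mem_index_enum i).
by rewrite !mxE -expr2 sqrf_eq0 => /eqP.
Qed.

Lemma mulmx_tr_gt0 n (x : 'rV[R]_n) : x != 0 -> 0 < (x *m x^T) 0 0.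
Proof.
move=> xn0; rewrite lt_def mulmx_tr_ge0 andbT; apply: contra xn0 => /eqP.
by move/mulmx_tr_eq0 => ->.
Qed.

(* If [x + iy] is a complex eigenvector for [a + ib], then computing
   [x A y^T] in two ways gives [b (|x|^2 + |y|^2) = 0]. *)
Lemma symmetric_eigenvalue n (A : 'M[R]_n.+1) : A^T = A ->
  exists a, eigenvalue A a.
Proof.
move=> symA; set f := real_complex R.
have [z] := eigenvalue_closed (map_mx f A) (ltn0Sn n).
case: (z) => a b /eigenvalueP[v vA vn0].
pose x := map_mx (@complex.Re R) v; pose y := map_mx (@complex.Im R) v.
have ReS (I : Type) (r : seq I) (F : I -> R[i]) :
    complex.Re (\sum_(i <- r) F i) = \sum_(i <- r) complex.Re (F i).
  by elim/big_rec2: _ => // i u w _ <-; case: (F i) => ? ?; case: w.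
have ImS (I : Type) (r : seq I) (F : I -> R[i]) :
    complex.Im (\sum_(i <- r) F i) = \sum_(i <- r) complex.Im (F i).
  by elim/big_rec2: _ => // i u w _ <-; case: (F i) => ? ?; case: w.
have xA : x *m A = a *: x - b *: y.
  apply/rowP => j; have /rowP/(_ j)/(congr1 (@complex.Re R)) := vA.
  rewrite !mxE ReS; case: (v 0 j) => /= c e <-; apply: eq_bigr => k _.
  by rewrite !mxE; case: (v 0 k) => /= ? ?; rewrite mulr0 subr0.
have yA : y *m A = a *: y + b *: x.
  apply/rowP => j; have /rowP/(_ j)/(congr1 (@complex.Im R)) := vA.
  rewrite !mxE ImS; case: (v 0 j) => /= c e <-; apply: eq_bigr => k _.
  by rewrite !mxE; case: (v 0 k) => /= ? ?; rewrite mulr0 add0r.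
have : ((x *m A) *m y^T) 0 0 = (x *m (y *m A)^T) 0 0.
  by rewrite trmx_mul symA mulmxA.
rewrite xA yA mulmxBl -!scalemxAl linearD/= !linearZ/= mulmxDr -!scalemxAr.
rewrite ![in LHS]mxE ![in RHS]mxE -/(x *m y^T) -/(y *m y^T) -/(x *m x^T).
move=> eb; have b0 : b = 0.
  apply: contrapT => /eqP bn0.
  have e0 : (x *m x^T) 0 0 + (y *m y^T) 0 0 = 0.
    apply: (mulfI bn0); rewrite mulr0 !mxE; lra.
  have [x0 y0] : x = 0 /\ y = 0.
    by split; apply: mulmx_tr_eq0; move: (mulmx_tr_ge0 x) (mulmx_tr_ge0 y); lra.
  move/eqP: vn0; apply; apply/rowP => j; rewrite [RHS]mxE.
  move: x0 y0 => /rowP/(_ j) + /rowP/(_ j); rewrite !mxE.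
  by case: (v 0 j) => ? ? /= -> ->.
exists a; rewrite -(eigenvalue_map f); apply/eigenvalueP.
by exists v => //; rewrite vA b0.
Qed.

(** If [u] differs from [e0], the reflection in the hyperplane orthogonal to [u - e0] exchanges
    these two unit vectors. *)
Lemma householder n (u : 'rV[R]_n.+1) : u *m u^T = 1%:M ->
  exists2 H : 'M[R]_n.+1, H *m H^T = 1%:M & delta_mx 0 0 *m H = u.
Proof.
move=> uu; pose e0 : 'rV[R]_n.+1 := delta_mx 0 0.
have ee : e0 *m e0^T = 1%:M.
  by rewrite trmx_delta mul_delta_mx; apply/matrixP => i j; rewrite !mxE !ord1.
have [->|une] := eqVneq u e0.
  by exists 1%:M; rewrite ?trmx1 mulmx1.
pose w := u - e0; pose c : R := (w *m w^T) 0 0.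
have cgt0 : 0 < c by apply: mulmx_tr_gt0; rewrite subr_eq0.
have ww : w *m w^T = c%:M by rewrite [LHS]mx11_scalar.
have ew : e0 *m w^T = (- (c / 2))%:M.
  have ue : u *m e0^T = e0 *m u^T.
    by apply: trmx_inj; rewrite trmx_mul trmxK; apply/matrixP => i j; rewrite !ord1 [RHS]mxE.
  have -> : e0 *m w^T = e0 *m u^T - 1%:M by rewrite linearB/= mulmxBr ee.
  have cE : c = (1%:M - e0 *m u^T - (e0 *m u^T - 1%:M)) 0 0.
    by rewrite /c /w linearB/= mulmxBr !mulmxBl uu ue ee opprB.
  move: cE; rewrite [e0 *m u^T]mx11_scalar; move: ((e0 *m u^T) 0 0) => t cE.
  apply/matrixP => i j; rewrite !ord1; move: cE.
  by rewrite !mxE eqxx !mulr1n; lra.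
pose H := 1%:M - (2 / c) *: (w^T *m w).
have HT : H^T = H.
  by rewrite /H linearB/= trmx1 linearZ/= trmx_mul trmxK.
exists H; last first.
  rewrite /H mulmxBr mulmx1 -scalemxAr mulmxA ew mul_scalar_mx scalerA.
  have -> : 2 / c * - (c / 2) = -1 by field; rewrite gt_eqF.
  by rewrite scaleN1r opprK /w addrC subrK.
rewrite HT /H mulmxBr mulmx1 mulmxBl mul1mx -scalemxAl -scalemxAr.
rewrite mulmxA -[w^T *m w *m w^T]mulmxA ww mul_mx_scalar -scalemxAl !scalerA.
rewrite -[RHS]subr0 -addrA; congr (_ + _).
rewrite -opprD -scalerBl -scalerDl.
suff -> : 2 / c + (2 / c - 2 / c * (2 / c * c)) = 0 by rewrite scale0r.
by field; rewrite gt_eqF.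
Qed.

(** Induction on the dimension: a reflection turns a unit eigenvector into the first basis vector.
    By symmetry the conjugated matrix is then block diagonal, and the induction hypothesis handles
    the lower block. *)
Theorem symmetric_spectral_dec n (A : 'M[R]_n) : A^T = A ->
  exists U d, spectral_dec A U d.
Proof.
elim: n A => [|n IHn] A symA.
  by exists 1%:M, 0; split; apply/matrixP => -[].
have [a /eigenvalueP[v vA vn0]] := symmetric_eigenvalue symA.
pose c := (v *m v^T) 0 0; have cgt0 : 0 < c by exact: mulmx_tr_gt0.
pose u := (Num.sqrt c)^-1 *: v.
have uA : u *m A = a *: u by rewrite -scalemxAl vA !scalerA mulrC.
have uu : u *m u^T = 1%:M.
  rewrite linearZ/= -scalemxAl -scalemxAr [v *m _]mx11_scalar -/c !scale_scalar_mx.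
  by rewrite mulrA -invfM -expr2 sqr_sqrtr ?ltW// mulVf ?gt_eqF.
have [H HH eH] := householder uu.
have HH' : H^T *m H = 1%:M by apply: mulmx1C.
pose M : 'M[R]_(1 + n) := H *m A *m H^T.
have symM : M^T = M by rewrite /M !trmx_mul trmxK symA mulmxA.
have M0 j : M 0 j = a *+ (j == 0).
  have -> : M 0 j = (delta_mx 0 0 *m M : 'rV[R]_(1 + n)) 0 j by rewrite -rowE [RHS]mxE.
  rewrite /M !mulmxA eH uA -scalemxAl -eH -mulmxA HH mulmx1 !mxE.
  by case: (j == 0); rewrite ?mulr1 ?mulr0.
have MH : M *m H = H *m A by rewrite /M -[_ *m H^T *m H]mulmxA HH' mulmx1.
clearbody M; pose M' := drsubmx M.
have Mul : ulsubmx M = a%:M.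
  by apply/matrixP => i j; rewrite !ord1 !mxE lshift0 M0.
have Mur : ursubmx M = 0.
  by apply/matrixP => i j; rewrite !ord1 !mxE lshift0 M0.
have Mdl : dlsubmx M = 0 by rewrite -symM -trmx_ursub Mur trmx0.
have [|U' [d' [UU UM]]] := IHn M'; first by rewrite trmx_drsub symM.
have ME : M = block_mx a%:M 0 0 M' by rewrite -Mul -{1}Mur -Mdl submxK.
pose V : 'M[R]_(1 + n) := block_mx 1%:M 0 0 U'.
have VV : V *m V^T = 1%:M.
  rewrite /V tr_block_mx mulmx_block !trmx0 !trmx1 !mulmx0 !mul0mx !addr0 !add0r.
  by rewrite mulmx1 UU -scalar_mx_block.
have VM : V *m M = diag_mx (row_mx a%:M d') *m V.
  rewrite ME /V diag_mx_row !mulmx_block !mulmx0 !mul0mx !addr0 !add0r mul1mx mulmx1.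
  congr block_mx; last by [].
  by apply/matrixP => i j; rewrite !ord1 !mxE.
exists (V *m H), (row_mx a%:M d' : 'rV[R]_(1 + n)); split.
  by rewrite trmx_mul mulmxA -[V *m H *m _]mulmxA HH mulmx1.
by rewrite -mulmxA -MH !mulmxA VM.
Qed.

End Spectral.

(** * Eigenvalues and characteristic polynomials *)

Lemma char_poly_intertwine (F : fieldType) n (A B U : 'M[F]_n) :
  U \in unitmx -> U *m A = B *m U -> char_poly A = char_poly B.
Proof.
move=> Uu UA; pose C := map_mx (@polyC F) U.
have Cn0 : \det C != 0.
  by rewrite det_map_mx polyC_eq0 -unitfE -unitmxE.
apply: (mulfI Cn0); rewrite -det_mulmx mulrC -det_mulmx; congr (\det _).
by rewrite /char_poly_mx mulmxBr mulmxBl -!map_mxM UA scalar_mxC.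
Qed.

Lemma char_poly_lblock (F : fieldType) m n (A : 'M[F]_m) C (B : 'M[F]_n) :
  char_poly (block_mx A 0 C B) = char_poly A * char_poly B.
Proof.
rewrite /char_poly /char_poly_mx map_block_mx map_mx0 scalar_mx_block.
by rewrite opp_block_mx add_block_mx subrr det_lblock.
Qed.

(** The invertible [P] intertwines [[[0, 0], [B, BA]]] with [[[AB, 0], [B, 0]]]; the common factor
    [char_poly 0] cancels. *)
Lemma char_poly_mulmxC (F : fieldType) n (A B : 'M[F]_n) :
  char_poly (A *m B) = char_poly (B *m A).
Proof.
pose P : 'M[F]_(n + n) := block_mx 1%:M A 0 1%:M.
have Pu : P \in unitmx.
  by rewrite unitmxE det_ublock !det1 mulr1 unitr1.
have := @char_poly_intertwine F _ (block_mx 0 0 B (B *m A))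
  (block_mx (A *m B) 0 B 0) P Pu.
rewrite !char_poly_lblock => H; apply: (@mulfI _ (char_poly (0 : 'M[F]_n))).
  by rewrite monic_neq0 // char_poly_monic.
rewrite mulrC -H // /P !mulmx_block !mulmx0 !mul0mx !mulmx1 !mul1mx.
by rewrite !addr0 !add0r mulmxA.
Qed.

Section EigenvalueSums.
Variable R : realType.

Lemma spectral_dec_trK n (A U : 'M[R]_n) d : spectral_dec A U d -> U^T *m U = 1%:M.
Proof. by move=> [UU _]; exact: mulmx1C. Qed.

Lemma spectral_dec_unit n (A U : 'M[R]_n) d : spectral_dec A U d -> U \in unitmx.
Proof. by move=> [/mulmx1_unit[]]. Qed.

Lemma spectral_dec_conj n (A U : 'M[R]_n) d : spectral_dec A U d ->
  U *m A *m U^T = diag_mx d.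
Proof. by move=> [UU ->]; rewrite -mulmxA UU mulmx1. Qed.

Lemma spectral_dec_sqr n (A U : 'M[R]_n) d : spectral_dec A U d ->
  spectral_dec (A *m A) U (\row_i (d 0 i ^+ 2)).
Proof.
move=> [UU UA]; split=> //.
by rewrite mulmxA UA -mulmxA UA mulmxA mulmx_diag.
Qed.

Lemma char_poly_spectral n (A U : 'M[R]_n) d : spectral_dec A U d ->
  char_poly A = \prod_(x <- [seq d 0 i | i : 'I_n]) ('X - x%:P).
Proof.
move=> sA; rewrite (char_poly_intertwine (spectral_dec_unit sA) sA.2).
rewrite char_poly_trig ?diag_mx_is_trig // big_map big_enum.
by apply: eq_bigr => i _; rewrite mxE eqxx.
Qed.

(** The spectral theorem supplies a full root sequence, so for symmetric [A] the choice in
    [eigenvalues] does not fall back on its default. *)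
Lemma char_poly_eigenvalues n (A : 'M[R]_n) : A^T = A ->
  char_poly A = \prod_(x <- eigenvalues A) ('X - x%:P).
Proof.
move=> symA; rewrite /eigenvalues; case: xgetP => [s -> [] //|/= no].
have [U [d sA]] := symmetric_spectral_dec symA.
case: (no [seq d 0 i | i : 'I_n]); split; last exact: char_poly_spectral sA.
by rewrite size_map -cardE card_ord.
Qed.

Definition dilation n (p : 'M[R]_n) : 'M[R]_(n + n) := block_mx 0 p p^T 0.

Lemma dilation_sym n (p : 'M[R]_n) : (dilation p)^T = dilation p.
Proof. by rewrite /dilation tr_block_mx !trmx0 trmxK. Qed.

(** The square of the dilation has diagonal blocks [p p^T] and [p^T p], with equal characteristic
    polynomials. Hence the squares of its eigenvalues list every sigma twice. *)
Lemma sum_sigmas n (p : 'M[R]_n) U d (g : R -> R) :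
  spectral_dec (dilation p) U d ->
  \sum_(s <- sigmas p) g s = 2^-1 * \sum_i g (d 0 i ^+ 2).
Proof.
move=> /spectral_dec_sqr sD; set s := sigmas p.
have sE : \prod_(x <- s) ('X - x%:P) = char_poly (p *m p^T).
  by rewrite -char_poly_eigenvalues // trmx_mul trmxK.
have /prod_XsubC_eq ss : \prod_(x <- s ++ s) ('X - x%:P) =
    \prod_(x <- [seq (\row_i (d 0 i ^+ 2)) 0 i | i : 'I_(n + n)]) ('X - x%:P).
  rewrite -(char_poly_spectral sD) big_cat/= sE /dilation mulmx_block.
  by rewrite !mulmx0 !mul0mx !addr0 !add0r char_poly_lblock (char_poly_mulmxC p^T).
have : \sum_(x <- s ++ s) g x = _ := perm_big _ ss.
rewrite big_cat/= big_map big_enum/= => e.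
have -> : \sum_i g (d 0 i ^+ 2) = \sum_i g ((\row_i (d 0 i ^+ 2)) 0 i).
  by apply: eq_bigr => i _; rewrite mxE.
by rewrite -e; lra.
Qed.

End EigenvalueSums.

(** * Convexity of spectral sums *)

Section Convexity.
Variables (R : realType) (G dG : R -> R).
Hypothesis G_tangent : forall x y, G x + dG x * (y - x) <= G y.

(** The tangent at the mean [m], averaged over the points [x i], returns [G m], and it lies below
    [G] at each of them. *)
Lemma tangent_jensen (I : finType) (w x : I -> R) :
  (forall i, 0 <= w i) -> \sum_i w i = 1 ->
  G (\sum_i w i * x i) <= \sum_i w i * G (x i).
Proof.
move=> w0 w1; set m := \sum_i w i * x i.
have -> : G m = \sum_i w i * (G m + dG m * (x i - m)).
  under eq_bigr do rewrite mulrDr mulrCA mulrBr.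
  by rewrite big_split/= -mulr_sumr sumrB -/m -!mulr_suml w1 !mul1r subrr mulr0 addr0.
by apply: ler_sum => i _; apply: ler_wpM2l.
Qed.

Lemma orthogonal_row_sum n (P : 'M[R]_n) : P *m P^T = 1%:M ->
  forall i, \sum_k P i k ^+ 2 = 1.
Proof.
move=> PP i; have /matrixP/(_ i i) := PP; rewrite !mxE eqxx mulr1n => <-.
by apply: eq_bigr => k _; rewrite mxE expr2.
Qed.

(** The squared entries of [P = W U^T] are doubly stochastic. Row sums allow Jensen's inequality for
    each diagonal entry; column sums collapse the total. *)
Lemma peierls n (A U W : 'M[R]_n) d :
  spectral_dec A U d -> W *m W^T = 1%:M ->
  \sum_i G ((W *m A *m W^T) i i) <= \sum_k G (d 0 k).
Proof.
move=> sA WW; pose P := W *m U^T; have UU := spectral_dec_trK sA.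
have PP : P *m P^T = 1%:M.
  by rewrite /P trmx_mul trmxK mulmxA -[_ *m U^T *m U]mulmxA UU mulmx1.
have WAW i : (W *m A *m W^T) i i = \sum_k P i k ^+ 2 * d 0 k.
  have -> : W *m A *m W^T = P *m diag_mx d *m P^T.
    rewrite -(spectral_dec_conj sA) /P trmx_mul trmxK !mulmxA.
    by rewrite -[W *m U^T *m U]mulmxA UU mulmx1 -[_ *m U^T *m U]mulmxA UU mulmx1.
  rewrite mul_mx_diag mxE; apply: eq_bigr => k _.
  by rewrite !mxE expr2 mulrAC.
apply: (@le_trans _ _ (\sum_i \sum_k P i k ^+ 2 * G (d 0 k))).
  apply: ler_sum => i _; rewrite WAW; apply: tangent_jensen => [k|].
    exact: sqr_ge0.
  exact: orthogonal_row_sum.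
rewrite exchange_big/=; apply: ler_sum => k _; rewrite -mulr_suml.
have -> : \sum_i P i k ^+ 2 = 1.
  have := @orthogonal_row_sum _ P^T; rewrite trmxK => /(_ (mulmx1C PP) k) <-.
  by apply: eq_bigr => i _; rewrite [in RHS]mxE.
by rewrite mul1r.
Qed.

(** Both matrices are read in the eigenbasis [W] of their combination: scalar convexity acts on the
    diagonal entries, and [peierls] bounds each of the two sums. *)
Lemma spectral_sum_convex n (A B U V W : 'M[R]_n) d e f (t : R) :
  0 <= t <= 1 -> spectral_dec A U d -> spectral_dec B V e ->
  spectral_dec (t *: A + (1 - t) *: B) W f ->
  \sum_i G (f 0 i) <= t * \sum_i G (d 0 i) + (1 - t) * \sum_i G (e 0 i).
Proof.
move=> /andP[t0 t1] sA sB sM; have WW := sM.1; have t1' : 0 <= 1 - t by lra.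
apply: le_trans (lerD (ler_wpM2l t0 (peierls sA WW)) (ler_wpM2l t1' (peierls sB WW))).
rewrite !mulr_sumr -big_split/=; apply: ler_sum => i _.
have -> : f 0 i = t * (W *m A *m W^T) i i + (1 - t) * (W *m B *m W^T) i i.
  have /matrixP/(_ i i) := spectral_dec_conj sM.
  rewrite mulmxDr mulmxDl -!scalemxAr -!scalemxAl => e0.
  transitivity ((diag_mx f) i i); first by rewrite mxE eqxx mulr1n.
  by rewrite -e0 [LHS]mxE; congr (_ + _); rewrite mxE.
move: ((W *m A *m W^T) i i) ((W *m B *m W^T) i i) => x y.
(* With weights [t] and [1 - t], the slope terms of these two tangent inequalities cancel. *)
have := G_tangent (t * x + (1 - t) * y) x.
have := G_tangent (t * x + (1 - t) * y) y.
by move: (dG _) (G (t * x + _)) => a b; nra.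
Qed.

End Convexity.

(** * Divided differences *)

Section DividedDifference.
Variables (R : realType) (h dh : R -> R).

(** The value [dh x] on the diagonal gives joint continuity when [dh] is the continuous derivative
    of [h]. *)
Definition ddiff (x y : R) : R :=
  if x == y then dh x else (h y - h x) / (y - x).

Lemma ddiffE x y : h y - h x = ddiff x y * (y - x).
Proof.
rewrite /ddiff; have [->|xy] := eqVneq x y; first by rewrite !subrr mulr0.
by rewrite divfK // subr_eq0 eq_sym.
Qed.

Lemma ddiffxx x : ddiff x x = dh x.
Proof. by rewrite /ddiff eqxx. Qed.

Hypothesis h_derive : forall x : R, is_derive x 1 h (dh x).
Hypothesis dh_cont : continuous dh.

Lemma is_derive_cont : continuous h.
Proof.
by move=> x; apply: differentiable_continuous; apply/derivable1_diffP; case: (h_derive x).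
Qed.

Lemma ddiff_mvt x y : exists2 c, ddiff x y = dh c &
  x <= c <= y \/ y <= c <= x.
Proof.
have mvt a b : a < b -> exists2 c, h b - h a = dh c * (b - a) & a <= c <= b.
  move=> ab; have [|c + ->] := @MVT R h dh a b ab (fun x _ => h_derive x).
    by apply: continuous_subspaceT => z; exact: is_derive_cont.
  by rewrite in_itv/= => /andP[/ltW ac /ltW cb]; exists c => //; rewrite ac.
have [xy|yx|->] := ltgtP x y.
- have [c hc cxy] := mvt _ _ xy; exists c; last by left.
  by rewrite /ddiff lt_eqF // hc mulfK // subr_eq0 gt_eqF.
- have [c hc cxy] := mvt _ _ yx; exists c; last by right.
  rewrite /ddiff gt_eqF // -[h y - h x]opprB hc -[y - x]opprB invrN mulrNN.
  by rewrite mulfK // subr_eq0 gt_eqF.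
- by exists y; [rewrite ddiffxx | left; rewrite lexx].
Qed.

Lemma ddiff_bounded (M : R) : exists2 K, 0 <= K &
  forall x y, `|x| <= M -> `|y| <= M -> `|ddiff x y| <= K.
Proof.
have [M0|M0] := ltP M 0.
  by exists 0 => // x y xM; move: (normr_ge0 x); lra.
have [||c _ Kc] := @EVT_max R (fun x => `|dh x|) (- M) M; first by lra.
  apply: continuous_subspaceT => z; apply: (@continuous_comp _ _ _ dh (fun t : R => `|t|)).
    exact: dh_cont.
  exact: norm_continuous.
exists `|dh c| => // x y xM yM; have [z -> xzy] := ddiff_mvt x y; apply: Kc.
rewrite in_itv/=; move: xM yM; rewrite !ler_norml => /andP[? ?] /andP[? ?].
by case: xzy => /andP[? ?]; apply/andP; split; lra.
Qed.

(** On the diagonal, the mean value theorem reduces the claim to continuity of [dh]; off it, the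
    difference quotient is continuous. *)
Lemma ddiff_continuous (a b e : R) : 0 < e -> exists2 r, 0 < r &
  forall x y, `|x - a| <= r -> `|y - b| <= r -> `|ddiff x y - ddiff a b| <= e.
Proof.
move=> e0; have [<-|ab] := eqVneq a b.
  have /cvgrPdist_le/(_ e e0)/nbhs_ballP[r /= r0 dhr] := @dh_cont a.
  exists (r / 2); first by rewrite divr_gt0.
  move=> x y xa ya; have [z -> xzy] := ddiff_mvt x y.
  rewrite ddiffxx distrC; apply: dhr; rewrite /ball/= ltr_norml.
  move: xa ya; rewrite !ler_norml => /andP[? ?] /andP[? ?].
  by case: xzy => /andP[? ?]; apply/andP; split; lra.
pose q (z : R * R) := (h z.2 - h z.1) / (z.2 - z.1).
have qc : q z @[z --> (a, b)] --> q (a, b).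
  have c1 : z.1 @[z --> (a, b)] --> a by exact: cvg_fst.
  have c2 : z.2 @[z --> (a, b)] --> b by exact: cvg_snd.
  have h1 : h z.1 @[z --> (a, b)] --> h a.
    exact: (@cvg_comp _ _ _ fst h _ _ _ c1 (@is_derive_cont a)).
  have h2 : h z.2 @[z --> (a, b)] --> h b.
    exact: (@cvg_comp _ _ _ snd h _ _ _ c2 (@is_derive_cont b)).
  apply: cvgM; first exact: cvgB h2 h1.
  by apply: cvgV (cvgB c2 c1); rewrite subr_eq0 eq_sym.
have /cvgrPdist_le/(_ e e0)/nbhs_ballP[r /= r0 qr] := qc.
have d0 : 0 < `|a - b| by rewrite normr_gt0 subr_eq0.
(* Halving [r] lands in the open ball; a third of [|a - b|] forces [x] and [y] to be distinct. *)
exists (Num.min (r / 2) (`|a - b| / 3)); first by rewrite lt_min !divr_gt0.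
move=> x y; rewrite !le_min => /andP[xa xa'] /andP[yb yb'].
have xy : x != y.
  apply: contraTneq d0 => xy; rewrite -leNgt.
  have := ler_normB (y - b) (x - a); rewrite -xy in yb' *.
  have -> : x - b - (x - a) = a - b by ring.
  by lra.
rewrite /ddiff (negPf xy) (negPf ab) distrC; apply: (qr (x, y)).
by split; rewrite /ball/= distrC; lra.
Qed.

End DividedDifference.

(** The least of finitely many radii works; starting the minimum at 1 covers an empty index type. *)
Lemma fin_uniform (R : realType) (I : finType) (P : I -> R -> Prop) :
  (forall i, exists2 r, 0 < r & P i r) ->
  (forall i r s, r <= s -> P i s -> P i r) ->
  exists2 r, 0 < r & forall i, P i r.
Proof.
move=> ex mono.
have /choice[f fP] : forall i, exists r, 0 < r /\ P i r.
  by move=> i; have [r r0 Pr] := ex i; exists r.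
exists (\big[Order.min/1]_i f i).
  by apply: lt_bigmin => // i _; case: (fP i).
by move=> i; apply: (mono i _ (f i)); [exact: bigmin_le | case: (fP i)].
Qed.

(** * Perturbation of spectral functions *)

(** This norm dominates every entry of [U A V^T] for orthogonal [U] and [V]. *)
Definition mx_l1 (R : realType) m n (A : 'M[R]_(m, n)) : R :=
  \sum_i \sum_j `|A i j|.

(* [tr (h(A) B)] for the spectral decomposition [(U, d)] of [A] *)
Definition spectral_tr (R : realType) n (h : R -> R) (U : 'M[R]_n)
    (d : 'rV[R]_n) (B : 'M[R]_n) : R :=
  \sum_i h (d 0 i) * (U *m B *m U^T) i i.

(* The double operator integral [tr (T_phi(C) B)] attached to the spectral
   decompositions [(U, d)] and [(V, e)]. *)
Definition double_sum (R : realType) n (phi : R -> R -> R) (U : 'M[R]_n)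
    (d : 'rV[R]_n) (V : 'M[R]_n) (e : 'rV[R]_n) (B C : 'M[R]_n) : R :=
  \sum_i \sum_j phi (d 0 i) (e 0 j) * (U *m C *m V^T) i j * (V *m B *m U^T) j i.

Section Perturbation.
Variable R : realType.

Lemma mx_l1_ge0 m n (A : 'M[R]_(m, n)) : 0 <= mx_l1 A.
Proof. by apply: sumr_ge0 => i _; apply: sumr_ge0. Qed.

Lemma mx_l10 m n : mx_l1 (0 : 'M[R]_(m, n)) = 0.
Proof. by apply: big1 => i _; apply: big1 => j _; rewrite mxE normr0. Qed.

Lemma mx_l1D m n (A B : 'M[R]_(m, n)) : mx_l1 (A + B) <= mx_l1 A + mx_l1 B.
Proof.
rewrite /mx_l1 -big_split/=; apply: ler_sum => i _.
by rewrite -big_split/=; apply: ler_sum => j _; rewrite mxE ler_normD.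
Qed.

Lemma orthogonal_entry n (U : 'M[R]_n) i j : U *m U^T = 1%:M -> `|U i j| <= 1.
Proof.
move=> UU; rewrite -(@ler_pXn2r _ 2) ?nnegrE // expr1n real_normK ?num_real //.
rewrite -(orthogonal_row_sum UU i) (bigD1 j)//= lerDl.
by apply: sumr_ge0 => k _; rewrite sqr_ge0.
Qed.

Lemma orthogonal_conj_entry n (U V C : 'M[R]_n) i j :
  U *m U^T = 1%:M -> V *m V^T = 1%:M -> `|(U *m C *m V^T) i j| <= mx_l1 C.
Proof.
move=> UU VV; rewrite mxE /mx_l1 exchange_big/=.
apply: le_trans (ler_norm_sum _ _ _) _; apply: ler_sum => b _.
rewrite normrM [V^T b j]mxE.
apply: (@le_trans _ _ (`|(U *m C) i b| * 1)).
  by apply: ler_wpM2l => //; exact: orthogonal_entry.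
rewrite mulr1 mxE; apply: le_trans (ler_norm_sum _ _ _) _; apply: ler_sum => a _.
by rewrite normrM ler_piMl //; exact: orthogonal_entry.
Qed.

Lemma spectral_dec_sym n (A U : 'M[R]_n) d : spectral_dec A U d -> A^T = A.
Proof.
move=> sA; have UU := spectral_dec_trK sA.
have -> : A = U^T *m diag_mx d *m U by rewrite -mulmxA -sA.2 mulmxA UU mul1mx.
by rewrite !trmx_mul trmxK tr_diag_mx mulmxA.
Qed.

Lemma spectral_dec_tr n (A U : 'M[R]_n) d : spectral_dec A U d ->
  A *m U^T = U^T *m diag_mx d.
Proof.
move=> sA; apply: trmx_inj.
by rewrite !trmx_mul trmxK tr_diag_mx (spectral_dec_sym sA) sA.2.
Qed.

(** Here [U] diagonalizes [A] from the left and [V^T] diagonalizes [B] from the right. Eigenvectors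
    with distant eigenvalues therefore have small overlap when [B - A] is small. *)
Lemma spectral_gap n (A U B V : 'M[R]_n) d e i j :
  spectral_dec A U d -> spectral_dec B V e ->
  (e 0 j - d 0 i) * (U *m V^T) i j = (U *m (B - A) *m V^T) i j.
Proof.
move=> sA sB; rewrite mulmxBr mulmxBl sA.2 -[U *m B *m _]mulmxA.
rewrite (spectral_dec_tr sB) mulmxA -[diag_mx d *m U *m _]mulmxA.
move: (U *m V^T) => P; rewrite mul_mx_diag mul_diag_mx !mxE.
by rewrite mulrBl [e 0 j * _]mulrC.
Qed.

Lemma mxtrace_mulE n (A B : 'M[R]_n) : \tr (A *m B) = \sum_i \sum_j A i j * B j i.
Proof. by apply: eq_bigr => i _; rewrite mxE. Qed.

(** Both traces are expanded over the same overlaps [P i j]; the divided difference extracts the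
    factor [e_j - d_i], which [spectral_gap] converts into [A' - A]. *)
Lemma spectral_tr_perturb n (h dh : R -> R) (A U A' V B : 'M[R]_n) d e :
  spectral_dec A U d -> spectral_dec A' V e ->
  spectral_tr h V e B - spectral_tr h U d B =
  double_sum (ddiff h dh) U d V e B (A' - A).
Proof.
move=> sA sA'; have UU := spectral_dec_trK sA; have VV := spectral_dec_trK sA'.
pose P := U *m V^T; pose Q := V *m B *m U^T.
have QP : V *m B *m V^T = Q *m P.
  by rewrite /P /Q mulmxA -[_ *m U^T *m U]mulmxA UU mulmx1.
have PQ : U *m B *m U^T = P *m Q.
  by rewrite /P /Q !mulmxA -[_ *m V^T *m V]mulmxA VV mulmx1.
have -> : spectral_tr h V e B = \sum_i \sum_j h (e 0 j) * P i j * Q j i.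
  rewrite exchange_big/=; apply: eq_bigr => j _; rewrite QP [(Q *m P) j j]mxE.
  by rewrite mulr_sumr; apply: eq_bigr => i _; rewrite -mulrA [Q j i * _]mulrC.
have -> : spectral_tr h U d B = \sum_i \sum_j h (d 0 i) * P i j * Q j i.
  apply: eq_bigr => i _; rewrite PQ [(P *m Q) i i]mxE.
  by rewrite mulr_sumr; apply: eq_bigr => j _; rewrite mulrA.
rewrite -sumrB; apply: eq_bigr => i _; rewrite -sumrB; apply: eq_bigr => j _.
by rewrite -!mulrBl (ddiffE h dh) -[_ * _ * P i j]mulrA (spectral_gap i j sA sA').
Qed.

Lemma double_sum_diag n phi (A U : 'M[R]_n) d C : spectral_dec A U d ->
  double_sum phi U d U d 1%:M C = spectral_tr (fun x => phi x x) U d C.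
Proof.
move=> [UU _]; apply: eq_bigr => i _; rewrite mulmx1 UU.
rewrite (bigD1 i)//= big1 ?addr0 => [|j ji]; first by rewrite [1%:M _ _]mxE eqxx mulr1.
by rewrite [1%:M _ _]mxE (negPf ji) mulr0.
Qed.

(** Inserting the basis [W] puts both double sums over the same quadruples, where either the
    difference of [phi] or a product of overlaps can be made small. *)
Lemma double_sumE n phi (A U A' V A0 W B C : 'M[R]_n) d e a :
  spectral_dec A U d -> spectral_dec A' V e -> spectral_dec A0 W a ->
  double_sum phi U d V e B C - double_sum phi W a W a B C =
  \sum_i \sum_j \sum_l \sum_k
    (phi (d 0 i) (e 0 j) - phi (a 0 k) (a 0 l)) *
    ((U *m W^T) i k * (V *m W^T) j l) *
    ((W *m C *m W^T) k l * (V *m B *m U^T) j i).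
Proof.
move=> sA sA' sA0; have UU := spectral_dec_trK sA.
have VV := spectral_dec_trK sA'; have WW := spectral_dec_trK sA0.
pose P := U *m W^T; pose Q := V *m W^T; pose X := W *m C *m W^T.
pose Y := V *m B *m U^T; pose Z := \matrix_(k, l) (phi (a 0 k) (a 0 l) * X k l).
have UCV : U *m C *m V^T = P *m X *m Q^T.
  rewrite /P /X /Q trmx_mul trmxK !mulmxA -[U *m W^T *m W]mulmxA WW mulmx1.
  by rewrite -[_ *m W^T *m W]mulmxA WW mulmx1.
(* By cyclicity of the trace, [Q^T Y P] recombines to [W B W^T]. *)
have -> : double_sum phi W a W a B C = \tr (P *m Z *m Q^T *m Y).
  have -> : P *m Z *m Q^T *m Y = P *m (Z *m (Q^T *m Y)) by rewrite !mulmxA.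
  rewrite mxtrace_mulC; have -> : Z *m (Q^T *m Y) *m P = Z *m (W *m B *m W^T).
    rewrite /P /Q /Y trmx_mul trmxK -!mulmxA (mulmxA V^T) VV mul1mx.
    by rewrite (mulmxA U^T) UU mul1mx.
  rewrite mxtrace_mulE; apply: eq_bigr => i _; apply: eq_bigr => j _.
  by rewrite [Z i j]mxE.
rewrite mxtrace_mulE -sumrB; apply: eq_bigr => i _.
rewrite -sumrB; apply: eq_bigr => j _.
rewrite UCV -mulrBl.
have PXQ (M : 'M[R]_n) : (P *m M *m Q^T) i j = \sum_l \sum_k M k l * (P i k * Q j l).
  rewrite mxE; apply: eq_bigr => l _; rewrite [(P *m M) i l]mxE [Q^T l j]mxE mulr_suml.
  by apply: eq_bigr => k _; ring.
rewrite !PXQ mulr_sumr -sumrB mulr_suml; apply: eq_bigr => l _.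
rewrite mulr_sumr -sumrB mulr_suml; apply: eq_bigr => k _.
by rewrite [Z k l]mxE -/X -/Y -/P -/Q; ring.
Qed.

Lemma spectral_dec_eigen_le n (A U : 'M[R]_n) d i : spectral_dec A U d ->
  `|d 0 i| <= mx_l1 A.
Proof.
move=> sA; have := orthogonal_conj_entry A i i sA.1 sA.1.
by rewrite (spectral_dec_conj sA) mxE eqxx mulr1n.
Qed.

(** The bound is uniform in the choice of eigenbases and linear in [C]. In each quadruple,
    eigenvalues within [r] give a small difference of [phi]; otherwise an overlap is small and the
    difference is merely bounded. *)
Lemma double_sum_continuous n (h dh : R -> R) (A0 W B : 'M[R]_n) a (eps : R) :
  (forall x : R, is_derive x 1 h (dh x)) -> continuous dh ->
  spectral_dec A0 W a -> 0 < eps ->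
  exists2 del, 0 < del & forall A U d A' V e C,
    spectral_dec A U d -> spectral_dec A' V e ->
    mx_l1 (A - A0) <= del -> mx_l1 (A' - A0) <= del ->
    `|double_sum (ddiff h dh) U d V e B C -
      double_sum (ddiff h dh) W a W a B C| <= eps * mx_l1 C.
Proof.
move=> hd hc sA0 eps0; pose phi := ddiff h dh.
(* There are n^4 quadruples; adding 1 keeps [N] positive. *)
pose N : R := (n * n * n * n)%:R * mx_l1 B + 1.
have N0 : 0 < N by rewrite ltr_wpDl // mulr_ge0 // mx_l1_ge0.
pose e0 := eps / N; have e00 : 0 < e0 by rewrite divr_gt0.
have [K K0 HK] := ddiff_bounded hd hc (mx_l1 A0 + 1).
have [r r0 Hr] : exists2 r, 0 < r & forall kl : 'I_n * 'I_n, forall x y,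
    `|x - a 0 kl.1| <= r -> `|y - a 0 kl.2| <= r ->
    `|phi x y - phi (a 0 kl.1) (a 0 kl.2)| <= e0.
  apply: fin_uniform => [[k l]|[k l] s t st H x y xs ys].
    exact: ddiff_continuous.
  by apply: H; apply: le_trans st.
pose K1 := 2 * K + 1; have K10 : 0 < K1 by rewrite /K1; lra.
(* The bound 1 keeps all eigenvalues in the range where [K] applies; the other bound makes overlaps
   across a gap larger than [r] at most [e0 / K1]. *)
exists (Num.min 1 (r * e0 / K1)); first by rewrite lt_min ltr01 divr_gt0 // mulr_gt0.
move=> A U d A' V e C sA sA'; rewrite !le_min => /andP[A1 Ar] /andP[A'1 A'r].
have eigen_le (M T : 'M[R]_n) f i : spectral_dec M T f -> mx_l1 (M - A0) <= 1 ->
    `|f 0 i| <= mx_l1 A0 + 1.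
  move=> sM M1; apply: le_trans (spectral_dec_eigen_le i sM) _.
  by have := mx_l1D (M - A0) A0; rewrite subrK; lra.
have a_le i : `|a 0 i| <= mx_l1 A0 + 1.
  by have := spectral_dec_eigen_le i sA0; lra.
have phi2 i j k l : `|phi (d 0 i) (e 0 j) - phi (a 0 k) (a 0 l)| <= K1.
  apply: le_trans (ler_normB _ _) _.
  have := HK _ _ (a_le k) (a_le l).
  have := HK _ _ (eigen_le _ _ _ i sA A1) (eigen_le _ _ _ j sA' A'1).
  by rewrite /K1 /phi; lra.
have orth (M T : 'M[R]_n) f : spectral_dec M T f ->
    (T *m W^T) *m (T *m W^T)^T = 1%:M.
  move=> [TT _]; rewrite trmx_mul trmxK mulmxA -[_ *m W^T *m W]mulmxA.
  by rewrite (spectral_dec_trK sA0) mulmx1.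
have small (M T : 'M[R]_n) f i k : spectral_dec M T f ->
    mx_l1 (M - A0) <= r * e0 / K1 -> r < `|f 0 i - a 0 k| ->
    K1 * `|(T *m W^T) i k| <= e0.
  move=> sM Mr rf; have := spectral_gap i k sM sA0.
  move/(congr1 (fun t : R => `|t|)); rewrite normrM distrC => gap.
  have : r * `|(T *m W^T) i k| <= r * e0 / K1.
    apply: le_trans Mr; apply: (@le_trans _ _ (`|f 0 i - a 0 k| * `|(T *m W^T) i k|)).
      by apply: ler_wpM2r => //; exact: ltW.
    rewrite gap -opprB mulmxN mulNmx mxE normrN.
    exact: orthogonal_conj_entry sM.1 sA0.1.
  by rewrite -mulrA ler_pM2l // ler_pdivlMr // mulrC.
have key i j k l : `|(phi (d 0 i) (e 0 j) - phi (a 0 k) (a 0 l)) *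
    ((U *m W^T) i k * (V *m W^T) j l)| <= e0.
  have P1 := orthogonal_entry i k (orth _ _ _ sA).
  have Q1 := orthogonal_entry j l (orth _ _ _ sA').
  rewrite !normrM; have [xr|rx] := leP `|d 0 i - a 0 k| r; last first.
    apply: le_trans (small _ _ _ _ _ sA Ar rx).
    by apply: ler_pM => //; rewrite ler_piMr.
  have [yr|ry] := leP `|e 0 j - a 0 l| r; last first.
    apply: le_trans (small _ _ _ _ _ sA' A'r ry).
    by apply: ler_pM => //; rewrite ler_piMl.
  rewrite -[leRHS]mulr1; apply: ler_pM => //; first exact: (Hr (k, l)).
  by rewrite -[leRHS]mulr1; apply: ler_pM.
rewrite (double_sumE _ _ _ sA sA' sA0).
apply: (@le_trans _ _ (\sum_(i < n) \sum_(j < n) \sum_(l < n) \sum_(k < n)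
    e0 * (mx_l1 C * mx_l1 B))).
  do 4![apply: le_trans (ler_norm_sum _ _ _) _; apply: ler_sum => ? _].
  rewrite normrM; apply: ler_pM => //.
  rewrite normrM; apply: ler_pM => //.
    exact: orthogonal_conj_entry sA0.1 sA0.1.
  exact: orthogonal_conj_entry sA'.1 sA.1.
rewrite !sumr_const !card_ord -!mulrnA -mulr_natr.
have C0 := mx_l1_ge0 C.
have -> : eps = e0 * N by rewrite divfK // gt_eqF.
rewrite [leRHS](_ : _ = e0 * (mx_l1 C * mx_l1 B) * (n * n * n * n)%:R + e0 * mx_l1 C).
  by rewrite !mulnA lerDl mulr_ge0 // ltW.
by rewrite /N; ring.
Qed.

End Perturbation.

(** * Linear families of symmetric matrices *)

Lemma differentiable_estimate (R : realType) (V : normedModType R) (f : V -> R)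
    (df : {linear V -> R}) (K : R) (x : V) :
  (forall v, `|df v| <= K * `|v|) ->
  (forall e, 0 < e -> \forall y \near x, `|f y - f x - df (y - x)| <= e * `|y - x|) ->
  differentiable f x /\ 'd f x = df :> (V -> R).
Proof.
move=> dfK est.
have dfc : continuous df.
  move=> y; apply/cvgrPdist_le => e e0; apply/nbhs_ballP.
  (* The sign of [K] is unknown, hence the positive constant [|K| + 1]. *)
  exists (e / (`|K| + 1)) => /=; first by rewrite divr_gt0 // ltr_wpDl.
  move=> z; rewrite -ball_normE/= => yz; rewrite -linearB/=.
  apply: le_trans (dfK _) _; apply: (@le_trans _ _ ((`|K| + 1) * `|y - z|)).
    apply: ler_wpM2r => //; have := ler_norm K; lra.
  by rewrite mulrC -ler_pdivlMr ?ltr_wpDl // ltW.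
have H : f \o shift x = cst (f x) + df +o_ 0 id.
  apply/eqaddoP => e e0; have /nbhs_ballP[r /= r0 Hr] := est e e0.
  apply/nbhs_ballP; exists r => //= h; rewrite -ball_normE/= sub0r normrN => hr.
  have := Hr (h + x); rewrite addrK -ball_normE/= opprD addrCA subrr addr0 normrN.
  by move=> /(_ hr); rewrite /= opprD addrA.
have dE := diff_unique dfc H; split => //.
by apply/diff_locallyP; rewrite dE.
Qed.

Section SpectralFamily.
Variables (R : realType) (V : normedModType R) (m : nat).
Variables (L : {linear V -> 'M[R]_m}) (U : V -> 'M[R]_m) (d : V -> 'rV[R]_m).
Hypothesis sL : forall p, spectral_dec (L p) (U p) (d p).
Variable k : R.
Hypothesis k0 : 0 <= k.
Hypothesis L_le : forall p, mx_l1 (L p) <= k * `|p|.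

Lemma linear_family_near (x : V) (e : R) : 0 < e -> \forall y \near x, mx_l1 (L y - L x) <= e.
Proof.
move=> e0; apply/nbhs_ballP; exists (e / (k + 1)) => /=.
  by rewrite divr_gt0 // ltr_wpDl.
move=> y; rewrite -ball_normE/= distrC => xy; rewrite -linearB.
apply: le_trans (L_le _) _; apply: (@le_trans _ _ ((k + 1) * `|y - x|)).
  by apply: ler_wpM2r => //; lra.
by rewrite mulrC -ler_pdivlMr ?ltr_wpDl // ltW.
Qed.

Section OneFunction.
Variables (h dh : R -> R) (B : 'M[R]_m).
Hypothesis h_derive : forall x : R, is_derive x 1 h (dh x).
Hypothesis dh_cont : continuous dh.

(** This is the Daletskii-Krein formula for the derivative of [tr (h(L p) B)] at [x] in direction
    [v]. *)
Definition spectral_diff (x v : V) : R :=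
  double_sum (ddiff h dh) (U x) (d x) (U x) (d x) B (L v).

Lemma spectral_diff_linear x : linear (spectral_diff x).
Proof.
move=> a u v; rewrite /spectral_diff /double_sum /GRing.scale/= mulr_sumr -big_split/=.
apply: eq_bigr => i _; rewrite mulr_sumr -big_split/=; apply: eq_bigr => j _.
rewrite linearP mulmxDr mulmxDl -scalemxAr -scalemxAl [(_ + _ : 'M[R]_m) i j]mxE.
by rewrite [(a *: _ : 'M[R]_m) i j]mxE; ring.
Qed.

HB.instance Definition _ x :=
  GRing.isLinear.Build R V R *:%R (spectral_diff x) (@spectral_diff_linear x).

Lemma spectral_diff_bounded x : exists K, forall v, `|spectral_diff x v| <= K * `|v|.
Proof.
exists ((\sum_(i < m) \sum_(j < m) `|ddiff h dh (d x 0 i) (d x 0 j)| * mx_l1 B) * k) => v.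
rewrite -mulrA; apply: le_trans (_ : _ <= _ * mx_l1 (L v)) _; last first.
  apply: ler_wpM2l (L_le v).
  by do 2![apply: sumr_ge0 => ? _]; rewrite mulr_ge0 // mx_l1_ge0.
rewrite mulr_suml; apply: le_trans (ler_norm_sum _ _ _) _; apply: ler_sum => i _.
rewrite mulr_suml; apply: le_trans (ler_norm_sum _ _ _) _; apply: ler_sum => j _.
rewrite !normrM -!mulrA; apply: ler_wpM2l => //; rewrite mulrC.
have [UU _] := sL x.
by apply: ler_pM => //; exact: orthogonal_conj_entry.
Qed.

(** The exact increment is a double sum with one eigenbasis at [x] and one at [y]; replacing the
    latter by that at [x] costs only [e * |y - x|]. *)
Lemma spectral_tr_differentiable x :
  differentiable (fun p => spectral_tr h (U p) (d p) B) x /\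
  forall v, 'D_v (fun p => spectral_tr h (U p) (d p) B) x = spectral_diff x v.
Proof.
pose f p := spectral_tr h (U p) (d p) B.
have [K HK] := spectral_diff_bounded x.
have [] := @differentiable_estimate R V f (spectral_diff x) K x HK.
  move=> e e0; have e1 : 0 < e / (k + 1) by rewrite divr_gt0 // ltr_wpDl.
  have [r r0 Hr] := double_sum_continuous B h_derive dh_cont (sL x) e1.
  near=> y.
  rewrite /f (spectral_tr_perturb h dh B (sL x) (sL y)) -linearB.
  apply: le_trans (Hr _ _ _ _ _ _ _ (sL x) (sL y) _ _) _.
  - by rewrite subrr mx_l10 ltW.
  - by near: y; exact: linear_family_near.
  - rewrite -mulrA; apply: ler_wpM2l; first exact: ltW.
    rewrite ler_pdivrMl ?ltr_wpDl //; apply: le_trans (L_le _) _.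
    by apply: ler_wpM2r => //; lra.
by move=> df dE; split=> // v; rewrite deriveE // dE.
Unshelve. all: by end_near. Qed.

(** The same estimate, now with both decompositions taken at [y]. *)
Lemma spectral_diff_continuous v : continuous (spectral_diff ^~ v).
Proof.
move=> x; apply/cvgrPdist_le => e e0.
pose c := mx_l1 (L v) + 1; have c0 : 0 < c by rewrite ltr_wpDl // mx_l1_ge0.
have e1 : 0 < e / c by rewrite divr_gt0.
have [r r0 Hr] := double_sum_continuous B h_derive dh_cont (sL x) e1.
near=> y.
rewrite distrC; apply: le_trans (Hr _ _ _ _ _ _ _ (sL y) (sL y) _ _) _.
- by near: y; exact: linear_family_near.
- by near: y; exact: linear_family_near.
- by rewrite -mulrA ger_pMr // ler_pdivrMl // mulr1 /c; lra.
Unshelve. all: by end_near. Qed.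

End OneFunction.

(** With [B = 1] the double sum collapses to its diagonal, so the derivative along [v] is the
    spectral trace of [G1] against [L v], which can be differentiated again. *)
Theorem spectral_sum_C2 (G G1 G2 : R -> R) :
  (forall x : R, is_derive x 1 G (G1 x)) ->
  (forall x : R, is_derive x 1 G1 (G2 x)) -> continuous G2 ->
  C2_on (fun p => \sum_i G (d p 0 i)).
Proof.
move=> dG dG1 cG2; have cG1 := is_derive_cont dG1.
have -> : (fun p => \sum_i G (d p 0 i)) = fun p => spectral_tr G (U p) (d p) 1%:M.
  apply/funext => p; apply: eq_bigr => i _.
  by rewrite mulmx1 (sL p).1 mxE eqxx mulr1.
have D1 v : 'D_v (fun p => spectral_tr G (U p) (d p) 1%:M) =
    fun p => spectral_tr G1 (U p) (d p) (L v).
  apply/funext => x; rewrite (spectral_tr_differentiable _ dG cG1 x).2.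
  rewrite /spectral_diff (double_sum_diag _ _ (sL x)); apply: eq_bigr => i _.
  by rewrite ddiffxx.
split=> [x|]; first exact: (spectral_tr_differentiable _ dG cG1 x).1.
split=> v.
  by move=> x; rewrite D1; exact: (spectral_tr_differentiable _ dG1 cG2 x).1.
move=> w; rewrite D1 [X in continuous X](_ : _ = spectral_diff G1 G2 (L v) ^~ w).
  exact: spectral_diff_continuous.
by apply/funext => x; rewrite (spectral_tr_differentiable _ dG1 cG2 x).2.
Qed.

End SpectralFamily.

(** * The dilation as a linear family *)

Section Dilation.
Variables (R : realType) (n : nat).

Lemma dilation_linear : linear (@dilation R n).
Proof.
move=> a p q; rewrite /dilation linearP scale_block_mx add_block_mx.
by rewrite !scaler0 !addr0.
Qed.

HB.instance Definition _ :=
  GRing.isLinear.Build R 'M[R]_n 'M[R]_(n + n) *:%R (@dilation R n) dilation_linear.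

Lemma mx_entry_le_norm (p : 'M[R]_n) i j : `|p i j| <= `|p|.
Proof.
by rewrite [leRHS]/Num.norm/= mx_normrE; apply/bigmax_geP; right; exists (i, j).
Qed.

Lemma dilation_l1 (p : 'M[R]_n) :
  mx_l1 (dilation p) <= ((n + n) * (n + n))%:R * `|p|.
Proof.
apply: (@le_trans _ _ (\sum_(i < n + n) \sum_(j < n + n) `|p|)).
  apply: ler_sum => i _; apply: ler_sum => j _; rewrite /dilation.
  case: (split_ordP i) => i' ->; case: (split_ordP j) => j' ->.
  - by rewrite block_mxEul mxE normr0.
  - by rewrite block_mxEur mx_entry_le_norm.
  - by rewrite block_mxEdl mxE mx_entry_le_norm.
  - by rewrite block_mxEdr mxE normr0.
by rewrite !sumr_const !card_ord -mulrnA mulr_natl.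
Qed.

End Dilation.

(** * The scalar profile *)

(** The mean value theorem for [f] gives a point [c], and for [f1] a point [c']; the differences
    [c - x] and [y - x] have the same sign. *)
Lemma convex_tangent (R : realType) (f f1 f2 : R -> R) :
  (forall x : R, is_derive x 1 f (f1 x)) ->
  (forall x : R, is_derive x 1 f1 (f2 x)) -> (forall x, 0 <= f2 x) ->
  forall x y, f x + f1 x * (y - x) <= f y.
Proof.
move=> df df1 f20 x y.
have [c ec cxy] := ddiff_mvt df x y; have [c' ec' _] := ddiff_mvt df1 x c.
have := ddiffE f f1 x y; have := ddiffE f1 f2 x c; rewrite ec ec' => e1 e2.
have : 0 <= f2 c' * ((c - x) * (y - x)).
  apply: mulr_ge0 => //.
  by case: cxy => /andP[xc cy]; [apply: mulr_ge0 | apply: mulr_le0]; lra.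
have -> : f2 c' * ((c - x) * (y - x)) = (f1 c - f1 x) * (y - x) by rewrite e1 mulrA.
by rewrite mulrBl -e2; lra.
Qed.

Section Profile.
Variables (R : realType) (eps : R).
Hypothesis eps0 : 0 < eps.

(** With [t^2] in place of sigma, this is the l^4 norm of the vector [(eps^(1/2), t)]. *)
Definition quartic_norm (t : R) : R := Num.sqrt (Num.sqrt (eps ^+ 2 + (t ^+ 2) ^+ 2)).
Local Notation rho := quartic_norm.
Definition quartic_norm1 (t : R) : R := (t * t * t) * (rho t)^-1 ^+ 3.
Local Notation rho1 := quartic_norm1.
(** The terms are left in the shape that the product and power rules produce. *)
Definition quartic_norm2 (t : R) : R :=
  (t * t * t) * (3 * (rho t)^-1 ^+ 2 * (- (rho t)^-1 ^+ 2 * rho1 t)) +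
  (rho t)^-1 ^+ 3 * (3 * t * t).
Local Notation rho2 := quartic_norm2.

Lemma quartic_gt0 t : 0 < eps ^+ 2 + (t ^+ 2) ^+ 2.
Proof. by rewrite ltr_wpDr ?sqr_ge0 // exprn_gt0. Qed.

Lemma quartic_norm_gt0 t : 0 < rho t.
Proof. by rewrite !sqrtr_gt0 quartic_gt0. Qed.

Lemma quartic_norm4 t : rho t ^+ 4 = eps ^+ 2 + (t ^+ 2) ^+ 2.
Proof.
rewrite -[4%N]/(2 * 2)%N exprM sqr_sqrtr ?sqrtr_ge0 // sqr_sqrtr //.
exact/ltW/quartic_gt0.
Qed.

Lemma quartic_norm_derive (t : R) : is_derive t 1 rho (rho1 t).
Proof.
pose q (t : R) := eps ^+ 2 + (t ^+ 2) ^+ 2.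
have dq : is_derive t 1 q (4 * t ^+ 3).
  have : is_derive t 1 (cst (eps ^+ 2) + (id ^+ 2) ^+ 2 : R -> R) (4 * t ^+ 3).
    apply: is_derive_eq; rewrite add0r /GRing.scale/=.
    have -> : (id ^+ 2 : R -> R) t = t ^+ 2 by [].
    ring.
  by [].
have q0 : 0 < q t := quartic_gt0 t.
have sq0 : 0 < Num.sqrt (q t) by rewrite sqrtr_gt0.
have d1 := is_derive1_comp (is_derive1_sqrt q0) dq.
have := @is_derive1_comp R Num.sqrt (Num.sqrt \o q) t _ _ (is_derive1_sqrt sq0) d1.
move/is_derive_eq; apply; rewrite /rho1.
have -> : Num.sqrt (q t) = rho t ^+ 2 by rewrite sqr_sqrtr // sqrtr_ge0.
have r0 := quartic_norm_gt0 t; rewrite -/(rho t).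
have -> : Num.sqrt (rho t ^+ 2) = rho t by rewrite sqrtr_sqr gtr0_norm.
by field; rewrite gt_eqF.
Qed.

Lemma quartic_norm1_derive (t : R) : is_derive t 1 rho1 (rho2 t).
Proof.
have dV : is_derive t 1 (fun t => (rho t)^-1) (- (rho t)^-1 ^+ 2 * rho1 t).
  have := is_deriveV (lt0r_neq0 (quartic_norm_gt0 t)) (quartic_norm_derive t).
  by move/is_derive_eq; apply; rewrite exprVn.
have d3 : is_derive t 1 (fun t : R => t * t * t) (3 * t * t).
  have : is_derive t 1 (id * id * id : R -> R) (3 * t * t).
    apply: is_derive_eq; rewrite /GRing.scale/=.
    have -> : (id * id : R -> R) t = t * t by [].
    ring.
  by [].
have := is_deriveM d3 (is_deriveX 3 dV).
by move/is_derive_eq; apply.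
Qed.

Lemma quartic_norm_cont : continuous rho.
Proof. exact: is_derive_cont quartic_norm_derive. Qed.

Lemma quartic_norm1_cont : continuous rho1.
Proof. exact: is_derive_cont quartic_norm1_derive. Qed.

Lemma quartic_norm2_cont : continuous rho2.
Proof.
have cV : continuous (fun t => (rho t)^-1).
  move=> t; apply: continuousV; first by rewrite gt_eqF // quartic_norm_gt0.
  exact: quartic_norm_cont.
have cX k : continuous (fun t => (rho t)^-1 ^+ k).
  by move=> t; apply: (@continuous_comp _ _ _ (fun t => (rho t)^-1) (fun s => s ^+ k));
    [exact: cV | exact: exprn_continuous].
move=> t; apply: (@cvgD _ _ _ _ _
  (fun t => t * t * t * (3 * (rho t)^-1 ^+ 2 * (- (rho t)^-1 ^+ 2 * rho1 t)))
  (fun t => (rho t)^-1 ^+ 3 * (3 * t * t))).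
- apply: cvgM; first by apply: cvgM; first exact: cvgM.
  apply: cvgM; first by apply: cvgM; [exact: cvg_cst | exact: cX].
  by apply: cvgM; [apply: cvgN; exact: cX | exact: quartic_norm1_cont].
- apply: cvgM; first exact: cX.
  by apply: cvgM => //; apply: cvgM => //; exact: cvg_cst.
Qed.

(* Hoelder's inequality for the vectors [(eps^(1/2), x)] and [(eps^(1/2), y)]
   with exponents 4/3 and 4, by two applications of Cauchy-Schwarz. *)
Lemma quartic_norm_tangent x y : rho x + rho1 x * (y - x) <= rho y.
Proof.
have a0 := quartic_norm_gt0 x; have b0 := quartic_norm_gt0 y.
have a4 := quartic_norm4 x; have b4 := quartic_norm4 y.
rewrite /rho1; move: (rho x) (rho y) a0 b0 a4 b4 => a b a0 b0 a4 b4.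
have sqr_le (u v : R) : 0 <= v -> u ^+ 2 <= v ^+ 2 -> u <= v.
  move=> v0 uv; apply: le_trans (ler_norm u) _.
  by rewrite -(@ler_pXn2r _ 2) ?nnegrE // real_normK ?num_real.
have c1 : eps ^+ 2 + x ^+ 2 * y ^+ 2 <= a ^+ 2 * b ^+ 2.
  apply: sqr_le; first by rewrite mulr_ge0 ?sqr_ge0.
  have -> : (a ^+ 2 * b ^+ 2) ^+ 2 = a ^+ 4 * b ^+ 4 by ring.
  rewrite a4 b4 -subr_ge0.
  set z := (X in 0 <= X).
  have -> : z = (eps * (x ^+ 2 - y ^+ 2)) ^+ 2 by rewrite /z; ring.
  exact: sqr_ge0.
have c2 : eps ^+ 2 + x ^+ 3 * y <= a ^+ 3 * b.
  apply: sqr_le; first by rewrite mulr_ge0 ?exprn_ge0 // ltW.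
  apply: (@le_trans _ _ (a ^+ 4 * (eps ^+ 2 + x ^+ 2 * y ^+ 2))).
    rewrite a4 -subr_ge0; set z := (X in 0 <= X).
    have -> : z = (eps * (x ^+ 2 - x * y)) ^+ 2 by rewrite /z; ring.
    exact: sqr_ge0.
  have -> : (a ^+ 3 * b) ^+ 2 = a ^+ 4 * (a ^+ 2 * b ^+ 2) by ring.
  by apply: ler_wpM2l => //; rewrite exprn_ge0 // ltW.
have a3 : 0 < a ^+ 3 by rewrite exprn_gt0.
rewrite -(ler_pM2l a3) exprVn mulrDr.
have -> : a ^+ 3 * (x * x * x / a ^+ 3 * (y - x)) = x ^+ 3 * (y - x).
  by field; rewrite gt_eqF.
apply: le_trans c2; rewrite -exprSr a4 le_eqVlt; apply/orP; left; apply/eqP; ring.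
Qed.

End Profile.

Theorem theorem4p1 (R : realType) (n : nat) (eps nu1 nu2 nu3 : R)
  (psi : R -> R) :
  (0 < n)%N -> 0 < eps -> 0 < nu1 -> 0 < nu2 ->
  (forall y, 0 <= psi y) ->
  C2_real psi ->
  (forall y, psi (- y) = psi y) ->
  psi 0 = 0 ->
  (forall y, `|derive1 psi y| <= nu1) ->
  (forall y, nu2 * `|y| - nu3 <= psi y) ->
  (forall y, 0 < derive1 (derive1 psi) y) ->
  convex_fun (@Fstar R n psi eps) /\ C2_on (@Fstar R n psi eps).
Proof.
move=> _ eps0 _ _ psi_ge0 [dpsi [dpsi1 cpsi2]] _ psi0 _ _ psi2_gt0.
pose psi1 := derive1 psi; pose psi2 := derive1 psi1.
have Dpsi (x : R) : is_derive x 1 psi (psi1 x).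
  by apply: DeriveDef; [exact: dpsi | rewrite /psi1 derive1E].
have Dpsi1 (x : R) : is_derive x 1 psi1 (psi2 x).
  by apply: DeriveDef; [exact: dpsi1 | rewrite /psi2 derive1E].
have psi_tangent := convex_tangent Dpsi Dpsi1 (fun x => ltW (psi2_gt0 x)).
pose rho := quartic_norm eps; pose rho1 := quartic_norm1 eps.
pose rho2 := quartic_norm2 eps.
(* The factor 1/2 compensates for the double listing of each sigma by the dilation. *)
pose G t := 2^-1 * psi (rho t); pose G1 t := 2^-1 * (psi1 (rho t) * rho1 t).
pose G2 t := 2^-1 * (psi1 (rho t) * rho2 t + rho1 t * (psi2 (rho t) * rho1 t)).
have Drho := quartic_norm_derive eps0; have Drho1 := quartic_norm1_derive eps0.
have DG (t : R) : is_derive t 1 G (G1 t).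
  exact: (is_deriveZ 2^-1 (is_derive1_comp (Dpsi (rho t)) (Drho t))).
have DG1 (t : R) : is_derive t 1 G1 (G2 t).
  apply: (is_deriveZ 2^-1 (f := fun t => psi1 (rho t) * rho1 t)).
  exact: (is_deriveM (is_derive1_comp (Dpsi1 (rho t)) (Drho t)) (Drho1 t)).
have cG2 : continuous G2.
  have crho := quartic_norm_cont eps0; have crho1 := quartic_norm1_cont eps0.
  have cc (f : R -> R) : continuous f -> continuous (fun t => f (rho t)).
    by move=> cf t; apply: continuous_comp; [exact: crho | exact: cf].
  move=> t; apply: cvgM; first exact: cvg_cst.
  apply: cvgD; apply: cvgM.
  - exact: cc (is_derive_cont Dpsi1) t.
  - exact: quartic_norm2_cont.
  - exact: crho1.
  - by apply: cvgM; [exact: cc cpsi2 t | exact: crho1].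
(* The tangent at [t], evaluated at 0, gives [t * psi1 t >= psi t >= 0]. *)
have psi1_ge0 t : 0 < t -> 0 <= psi1 t.
  move=> t0; rewrite -(pmulr_rge0 _ t0).
  by have := psi_tangent t 0; rewrite psi0; have := psi_ge0 t; lra.
(* A nonnegative outer slope at [rho x] preserves the tangent inequality for [rho]. *)
have G_tangent x y : G x + G1 x * (y - x) <= G y.
  have := psi_tangent (rho x) (rho y).
  have := ler_wpM2l (psi1_ge0 _ (quartic_norm_gt0 eps0 x)) (quartic_norm_tangent eps0 x y).
  by rewrite /G /G1 -/rho -/rho1 mulrDr mulrA; lra.
(* The decompositions are chosen pointwise, with no continuity in [p]. *)
have /choice[Ud sUd] : forall p : 'M[R]_n, exists Ud : 'M[R]_(n + n) * 'rV[R]_(n + n),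
    spectral_dec (dilation p) Ud.1 Ud.2.
  by move=> p; have [U [d sd]] := symmetric_spectral_dec (dilation_sym p); exists (U, d).
have FE : @Fstar R n psi eps = fun p => \sum_i G ((Ud p).2 0 i).
  apply/funext => p; rewrite /Fstar.
  rewrite (sum_sigmas (fun s => psi (Num.sqrt (Num.sqrt (eps ^+ 2 + s ^+ 2)))) (sUd p)).
  by rewrite mulr_sumr.
rewrite FE; split.
  move=> x y t t01; have sxy := sUd (t *: x + (1 - t) *: y).
  have E : dilation (t *: x + (1 - t) *: y) = t *: dilation x + (1 - t) *: dilation y.
    by rewrite linearD !linearZ.
  rewrite E in sxy.
  exact: (spectral_sum_convex G_tangent t01 (sUd x) (sUd y) sxy).
apply: (@spectral_sum_C2 R 'M[R]_n (n + n) (@dilation R n) (fun p => (Ud p).1)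
  (fun p => (Ud p).2) sUd ((n + n) * (n + n))%:R _ _ G G1 G2) => //.
exact: dilation_l1.
Qed.
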